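(* Let $\epsilon\in\{-1,1\}$ and $c\in\mathbb Z$. A Laurent polynomial $u$ has the DOS property with respect to the symmetry type $\epsilon z^c$ if and only if (1) $u$ has real coefficients and $u^\star=u$; and (2) $u$ satisfies exactly one of the following conditions (according to $\epsilon$ and the parity of $c$): (i) if $\epsilon=1$ and $c$ is even, there is no condition on $u$; (ii) if $\epsilon=1$ and $c$ is odd, then $Z(u,x)$ is even for all $x\in(-1,0)$; (iii) if $\epsilon=-1$ and $c$ is even, then $Z(u,x)$ is even for all $x\in(-1,0)\cup(0,1)$; (iv) if $\epsilon=-1$ and $c$ is odd, then $Z(u,x)$ is even for all $x\in(0,1)$.
   Context: A Laurent polynomial is $u(z)=\sum_{k\in\mathbb Z}u(k)z^k$, $z\in\mathbb C\setminus\{0\}$, with finitely many nonzero $u(k)\in\mathbb C$; $u^\star(z):=\sum_k\overline{u(k)}z^{-k}$. $u$ has symmetry (of type $\epsilon z^c$) if $u(z)=\epsilon z^cu(z^{-1})$ for some $\epsilon\in\{\pm1\}$, $c\in\mathbb Z$; for nonzero such $u$, $\mathrm{S}u(z):=u(z)/u(z^{-1})=\epsilon z^c$; the zero polynomial has symmetry of every type. $Z(u,z_0)$ is the multiplicity of the zero $z_0\in\mathbb C\setminus\{0\}$ of $u$. A Laurent polynomial $u$ has the DOS property with respect to symmetry type $\epsilon z^c$ if there exist Laurent polynomials $u_1,u_2$ with symmetry such that $u_1u_1^\star-u_2u_2^\star=u$ and $\mathrm{S}u_1(z)/\mathrm{S}u_2(z)=\epsilon z^c$. *)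

(* Defs.v *)
(* complex numbers are R[i] (mathcomp-real-closed) for R : realType. *)
From HB Require Import structures.
From mathcomp Require Import all_boot all_order all_algebra.
From mathcomp Require Import complex.
From mathcomp Require Import reals.
Set Implicit Arguments. Unset Strict Implicit. Unset Printing Implicit Defensive.
Import Order.TTheory GRing.Theory Num.Theory.
Local Open Scope ring_scope.

Section Laurent.
Variable R : realType.
Local Notation C := R[i].

(* A Laurent polynomial u(z) = sum_k u(k) z^k with complex coefficients,
   given by its coefficient function together with a bound on its support. *)
Record laurent := Laurent {
  lc : int -> C;
  lb : nat;
  lbP : forall k : int, (lb < absz k)%N -> lc k = 0 }.

(* u^star(z) = sum_k conj(u(k)) z^(-k), i.e. coefficient k is conj(u(-k)). *)
Lemma lstar_bound (u : laurent) :
  forall k : int, (lb u < absz k)%N -> (lc u (- k))^* = 0.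
Proof. by move=> k hk; rewrite lbP ?abszN // conjC0. Qed.
Definition lstar (u : laurent) : laurent :=
  @Laurent (fun k => (lc u (- k))^*) (lb u) (@lstar_bound u).

(* coefficient k of the product u v : sum_j u(j) v(k - j) (u supported in [-lb u, lb u]) *)
Definition lmul (u v : laurent) : int -> C := fun k =>
  \sum_(j < (2 * lb u).+1) lc u (j%:Z - (lb u)%:Z) * lc v (k - (j%:Z - (lb u)%:Z)).

(* u has symmetry of type e z^c : u(z) = e z^c u(z^-1), i.e. u(k) = e u(c - k) for all k *)
Definition has_sym (u : laurent) (e : C) (c : int) : Prop :=
  (e = 1 \/ e = -1) /\ forall k : int, lc u k = e * lc u (c - k).

(* DOS property w.r.t. symmetry type eps z^c. *)
Definition DOS (u : laurent) (eps : C) (c : int) : Prop :=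
  exists (u1 u2 : laurent) (e1 e2 : C) (c1 c2 : int),
    [/\ has_sym u1 e1 c1, has_sym u2 e2 c2,
        (forall k, lmul u1 (lstar u1) k - lmul u2 (lstar u2) k = lc u k),
        e1 / e2 = eps & c1 - c2 = c].

(* the polynomial z^(lb u) u(z) *)
Definition lpoly (u : laurent) : {poly C} :=
  \poly_(j < (2 * lb u).+1) lc u (j%:Z - (lb u)%:Z).

(* Z(u, z0): multiplicity of the zero z0 <> 0 of u (equals 0 for u = 0, by mup) *)
Definition Zmult (u : laurent) (z0 : C) : nat := mup z0 (lpoly u).

End Laurent.

(* Main.v *)
Require Import Defs.
From HB Require Import structures.
From mathcomp Require Import all_boot all_order all_algebra.
From mathcomp Require Import complex ring lra zify.
From mathcomp Require Import reals.
Import Order.TTheory GRing.Theory Num.Theory.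
Local Open Scope ring_scope.
Set Implicit Arguments. Unset Strict Implicit. Unset Printing Implicit Defensive.

(** A real Laurent polynomial with u^star = u is u(z) = P(z + 1/z) for a real
polynomial P. If u1 has symmetry e z^c then u1 u1^star = e z^(-c) u1 u1bar
(u1bar having the conjugate coefficients). So at a real point where the two
signs e_i z^(-c_i) force both terms of the difference to have the same sign, a
zero of u is a common zero of u1 and u2, and (z - x)^2 can be divided out: the
multiplicity is even.

Conversely, writing X = z + 1/z, the products u1 u1^star are the polynomials
w(X) f(X) fbar(X) with w = 1, 2 + X, 2 - X or 4 - X^2 according to the type of
u1. Forms f fbar + p q g gbar and p f fbar + q g gbar are stable, up to exchange,
under multiplication by a^2 p + b^2 q (a quaternion norm identity). With
(p, q) = (1, -(X + 2)), (1, X - 2) or (X + 2, X - 2), every real root of P that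
is allowed to have odd multiplicity gives a factor +-(a^2 p + b^2 q), the other
roots pair up into norms, so that P itself is such a form up to sign. *)

Local Notation cjp p := (map_poly Num.conj p).

(** * Hermitian forms over polynomials *)

Section HermitianForms.
Variable C : numClosedFieldType.
Implicit Types (p q f g P : {poly C}) (x r : C).

Lemma map_conjK : involutive (fun p => cjp p).
Proof.
by move=> p; rewrite -map_poly_comp map_poly_id // => x _ /=; rewrite conjCK.
Qed.

(** In characteristic 0 the integers 1, 2, 3, ... are distinct and nonzero, so a nonzero difference
    would have too many roots among them. *)
Lemma eq_poly_nonzero p q : (forall z, z != 0 -> p.[z] = q.[z]) -> p = q.
Proof.
move=> epq; apply/eqP; rewrite -subr_eq0; apply/negPn/negP => d0.
pose s : seq C := [seq i.+1%:R | i <- iota 0 (size (p - q))].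
have := max_poly_roots (rs := s) d0; rewrite size_map size_iota ltnn => H.
suff: false by []; apply: H.
  apply/allP => _ /mapP[i _ ->].
  by rewrite /root hornerD hornerN epq ?subrr // pnatr_eq0.
rewrite map_inj_in_uniq ?iota_uniq // => i j _ _ /eqP.
by rewrite eqr_nat eqSS => /eqP.
Qed.

Lemma horner_conj p x : (cjp p).[x] = (p.[x^*])^*.
Proof. by rewrite -{1}(conjCK x) horner_map. Qed.

Lemma conj_XsubC x : cjp ('X - x%:P) = 'X - (x^*)%:P.
Proof. by rewrite rmorphB /= map_polyX map_polyC. Qed.

(** [mup] maximises over exponents at most the size, so its default at the zero polynomial is the
    even number 0, in keeping with the parity conditions. *)
Lemma mup0 x : mup x (0 : {poly C}) = 0%N.
Proof.
rewrite /mup; case: arg_maxnP => [|i _ _]; first by rewrite dvdp0.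
have := ltn_ord i; move: (nat_of_ord i) => m.
by rewrite size_poly0 ltnS leqn0 => /eqP.
Qed.

(* Where the two weights have the same sign, a zero of the form is a common
   zero of f and g, and can be divided out twice. *)
Lemma mup_form_even (W1 W2 : {poly C}) x f g :
  x \is Num.real -> 0 < W1.[x] * W2.[x] -> W1.[x] \is Num.real ->
  ~~ odd (mup x (W1 * (f * cjp f) + W2 * (g * cjp g))).
Proof.
move=> xr W12 W1r; have [n] := ubnP (size f + size g)%N.
elim: n f g => // n IH f g; rewrite ltnS => sz.
set D := _ + _.
have [->|D0] := eqVneq D 0; first by rewrite mup0.
have [Dx|/mupNroot -> //] := boolP (root D x).
have W1nz: W1.[x] != 0 by apply: contraTneq W12 => ->; rewrite mul0r ltxx.
have [fx gx] : root f x /\ root g x.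
  move: Dx; rewrite /root /D hornerD !hornerM !horner_conj (CrealP xr) -!normCK => /eqP E.
  (* Multiplying the vanishing value by W1(x) makes both terms nonnegative, so each of them is
     zero. *)
  have : W1.[x] ^+ 2 * `|f.[x]| ^+ 2 + (W1.[x] * W2.[x]) * `|g.[x]| ^+ 2 = 0.
    by rewrite expr2 -!mulrA -mulrDr E mulr0.
  move/eqP; rewrite paddr_eq0; first last.
  - by rewrite mulr_ge0 ?exprn_ge0 // ltW.
  - by apply: mulr_ge0; [apply: real_exprn_even_ge0 | apply: exprn_ge0].
  rewrite mulf_eq0 (mulf_eq0 (_ * _)) (gt_eqF W12) !sqrf_eq0 (negPf W1nz) /=.
  by rewrite !normr_eq0 => /andP.
case/factor_theorem: fx => f1 ef; case/factor_theorem: gx => g1 eg.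
have eD : D = ('X - x%:P) ^+ 2 * (W1 * (f1 * cjp f1) + W2 * (g1 * cjp g1)).
  by rewrite /D ef eg !rmorphM /= conj_XsubC (CrealP xr); ring.
have nz : W1 * (f1 * cjp f1) + W2 * (g1 * cjp g1) != 0.
  by apply: contraNneq D0 => E; rewrite eD E mulr0.
rewrite eD mupM // ?mup_XsubCX ?eqxx ?expf_neq0 ?polyXsubC_eq0 // oddD /=.
apply: IH.
(* f1 and g1 are not both zero, and removing X - x shortens each nonzero one, so the total size
   drops. *)
have [f0|f0] := eqVneq f1 0; have [g0|g0] := eqVneq g1 0.
- by move: nz; rewrite f0 g0 !mul0r !mulr0 addr0 eqxx.
all: move: sz; rewrite ef eg ?f0 ?g0 ?mul0r ?size_poly0 ?size_Mmonic ?monicXsubC //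
  ?size_XsubC; rewrite -?size_poly_gt0 in f0 g0; lia.
Qed.

(** * Real polynomials as signed forms in p and q *)

Section Representation.
Variables (p q : {poly C}) (bad : pred C).
Hypotheses (pr : cjp p = p) (qr : cjp q = q).
(** [bad] will be r < -2, 2 < r or their union: the images of (-1,0) and (0,1) under x + 1/x. *)
Hypothesis good_root : forall r, r \is Num.real -> ~~ bad r ->
  exists (a b s : C), [/\ a \is Num.real, b \is Num.real, s = 1 \/ s = -1 &
    'X - r%:P = s%:P * ((a ^+ 2)%:P * p + (b ^+ 2)%:P * q)].

Definition formA P := exists f g, P = f * cjp f + p * q * (g * cjp g).
Definition formB P := exists f g, P = p * (f * cjp f) + q * (g * cjp g).
(** Linear factors and constants are represented only up to sign, and each linear factor exchanges
    the two shapes; hence the sign and the disjunction. *)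
Definition signed_form P :=
  exists2 s : C, s = 1 \/ s = -1 & formA (s%:P * P) \/ formB (s%:P * P).

(** Replacing (f, g) by (h f, h g) multiplies either shape by h hbar. *)
Lemma signed_form_norm h P : signed_form P -> signed_form (h * cjp h * P).
Proof.
case=> s sE H; exists s => //; case: H => -[f [g E]]; [left|right];
  exists (h * f), (h * g); rewrite mulrCA E !rmorphM /=; ring.
Qed.

(* The witnesses come from the product of the quaternion-type matrices
   (f, - p q g; gbar, fbar), whose determinant is f fbar + p q g gbar. *)
Lemma signed_form_lin (a b s : C) P :
  a \is Num.real -> b \is Num.real -> s = 1 \/ s = -1 ->
  signed_form P ->
  signed_form (s%:P * ((a ^+ 2)%:P * p + (b ^+ 2)%:P * q) * P).
Proof.
move=> /CrealP ar /CrealP br sE [t tE H]; exists (s * t).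
  by case: sE tE => -> [] ->; rewrite ?mulr1 ?mul1r ?mulrNN ?mulr1; auto.
have -> : (s * t)%:P * (s%:P * ((a ^+ 2)%:P * p + (b ^+ 2)%:P * q) * P)
   = ((a ^+ 2)%:P * p + (b ^+ 2)%:P * q) * (t%:P * P).
  rewrite polyCM; have: s%:P * s%:P = 1 :> {poly C}.
    by rewrite -polyCM; case: sE => ->; rewrite ?mulrNN mulr1.
  by move=> E; rewrite -[RHS]mul1r -E; ring.
case: H => -[f [g ->]]; rewrite !rmorphXn /=.
- right; exists (a%:P * f - q * b%:P * cjp g), (b%:P * f + p * a%:P * cjp g).
  rewrite !(rmorphB, rmorphD, rmorphM) /= !map_polyC /= map_conjK pr qr ar br.
  by ring.
- left; exists (p * a%:P * f - q * b%:P * cjp g), (b%:P * f + a%:P * cjp g).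
  rewrite !(rmorphB, rmorphD, rmorphM) /= !map_polyC /= map_conjK pr qr ar br.
  by ring.
Qed.

Lemma signed_form_const (k : C) : k \is Num.real -> signed_form k%:P.
Proof.
wlog: k / 0 <= k => [H kr|k0 _].
  have /orP[|k0] := kr; first by move=> k0; apply: H.
  have [s sE sH] := H (- k) (ltac:(by rewrite oppr_ge0)) (ltac:(by rewrite realN)).
  exists (- s); first by case: sE => ->; rewrite ?opprK; auto.
  by move: sH; rewrite -!polyCM mulrN mulNr.
exists 1; first by left.
left; exists (sqrtC k)%:P, 0.
rewrite map_polyC /= (CrealP _) ?rmorph0 ?mulr0 ?addr0 ?mul1r.
  by rewrite -polyCM -expr2 sqrtCK.
by rewrite ger0_real // sqrtC_ge0.
Qed.

(** Induction on the size, removing roots: a nonreal root goes with its conjugate and a bad root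
    goes twice, both giving a norm; any other real root gives a linear factor covered by
    [signed_form_lin]. The parity hypothesis survives each removal. *)
Lemma real_poly_signed_form P : cjp P = P ->
  (forall r, r \is Num.real -> bad r -> ~~ odd (mup r P)) ->
  signed_form P.
Proof.
have [n] := ubnP (size P); elim: n P => // n IH P; rewrite ltnS => sz Pr Pm.
have [/eqP/size_poly1P [k k0 E]|s1] := eqVneq (size P) 1%N.
  rewrite E; apply: signed_form_const.
  by move: Pr; rewrite E map_polyC => /polyC_inj kr; apply/CrealP.
have [P0|P0] := eqVneq P 0.
  by rewrite P0; apply: (signed_form_const (k := 0)); rewrite real0.
have /closed_rootP [r] := s1.
(* The cofactor of a nonzero real factor is again real, as the induction hypothesis requires. *)
have divreal Q d : d != 0 -> cjp d = d -> P = d * Q -> cjp Q = Q.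
  move=> d0 dr E; apply: (mulfI d0); rewrite -E -Pr E rmorphM /=.
  by rewrite dr.
case/factor_theorem => P1 E1.
have P10 : P1 != 0 by apply: contraNneq P0 => E; rewrite E1 E mul0r.
have szP : size P = (size P1).+1.
  by rewrite E1 size_Mmonic ?monicXsubC // size_XsubC addn2.
have [rr|rnr] := boolP (r \is Num.real); last first.
  have rb : r^* != r by apply: contraNneq rnr => /CrealP.
  have : root P1 (r^*).
    have : root P (r^*).
      by rewrite /root -Pr horner_conj conjCK E1 !hornerE subrr mulr0 rmorph0.
    by rewrite E1 rootM root_XsubC (negPf rb) orbF.
  case/factor_theorem => P2 E2.
  have E : P = (('X - r%:P) * cjp ('X - r%:P)) * P2.
    by rewrite E1 E2 conj_XsubC; ring.
  have nz : ('X - r%:P) * cjp ('X - r%:P) != 0.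
    by rewrite conj_XsubC mulf_neq0 ?polyXsubC_eq0.
  have P20 : P2 != 0 by apply: contraNneq P10 => E'; rewrite E2 E' mul0r.
  rewrite E; apply: signed_form_norm; apply: IH.
  - have: (size P1 = (size P2).+1)%N.
      by rewrite E2 size_Mmonic ?monicXsubC // size_XsubC addn2.
    by move=> e; move: sz; rewrite szP e; apply: leq_trans.
  - by apply: divreal E => //; rewrite rmorphM /= map_conjK mulrC.
  move=> y yr yb; have := Pm y yr yb; rewrite E mupMr //.
  rewrite conj_XsubC rootM !root_XsubC; apply/norP; split.
    by apply: contraNneq rnr => <-.
  by apply: contraNneq rnr => e; rewrite -(conjCK r) -e (CrealP yr).
have [rb|rg] := boolP (bad r); last first.
  have [a [b [s [ar br sE E]]]] := good_root rr rg.
  have eP : P = ('X - r%:P) * P1 by rewrite E1 mulrC.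
  rewrite eP E; apply: signed_form_lin => //; apply: IH.
  - by rewrite -szP.
  - by apply: divreal eP; rewrite ?polyXsubC_eq0 // conj_XsubC (CrealP rr).
  move=> y yr yb; have := Pm y yr yb; rewrite eP mupMr //.
  by rewrite root_XsubC; apply: contraNneq rg => <-.
(* The multiplicity is positive and even, hence at least 2. *)
have m0 : (1 < mup r P)%N.
  have := Pm r rr rb; have : (0 < mup r P)%N.
    by rewrite -XsubC_dvd // E1 dvdp_mulIr.
  by case: (mup r P) => [|[]].
move: m0; rewrite mup_geq // => /dvdpP [P2 E].
have eP : P = (('X - r%:P) * cjp ('X - r%:P)) * P2.
  by rewrite E conj_XsubC (CrealP rr) -expr2 mulrC.
have P20 : P2 != 0 by apply: contraNneq P0 => E'; rewrite E E' mul0r.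
rewrite eP; apply: signed_form_norm; apply: IH.
- move: sz; rewrite E size_Mmonic ?monic_exp ?monicXsubC // size_exp_XsubC; lia.
- apply: divreal eP; last by rewrite rmorphM /= map_conjK mulrC.
  by rewrite conj_XsubC mulf_neq0 ?polyXsubC_eq0.
move=> y yr yb; have := Pm y yr yb.
rewrite E mupM ?expf_neq0 ?polyXsubC_eq0 // mup_XsubCX oddD.
by case: eqP => //=; rewrite addbF.
Qed.

End Representation.
End HermitianForms.

(** * The substitution X = z + 1/z *)

Section Joukowski.
Variable C : numClosedFieldType.
Implicit Types (z x r e : C) (p f g om w P L : {poly C}) (G : C -> C).

Lemma joukowski_numerator P :
  exists (H : {poly C}) (d : nat), forall z, z != 0 -> H.[z] = z ^+ d * P.[z + z^-1].
Proof.
elim/poly_ind: P => [|P k [H [d HE]]].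
  by exists 0, 0%N => z _; rewrite !horner0 mulr0.
exists (('X ^+ 2 + 1) * H + k *: 'X^(d.+1)), d.+1 => z z0.
rewrite !(hornerD, hornerM, hornerZ, hornerXn, hornerX, hornerC) HE // exprS.
have -> : z ^+ 2 + 1 = z * (z + z^-1) by rewrite mulrDr mulfV.
ring.
Qed.

(* 2 T_n(X / 2), with T_n the Chebyshev polynomial of the first kind. *)
Fixpoint cheb (n : nat) : {poly C} :=
  match n with
  | 0 => 2%:P
  | 1 => 'X
  | (m.+1 as m').+1 => 'X * cheb m' - cheb m
  end.

Lemma cheb_real n : cjp (cheb n) = cheb n.
Proof.
suff: cjp (cheb n) = cheb n /\ cjp (cheb n.+1) = cheb n.+1 by case.
elim: n => [|n [IH1 IH2]]; split=> //.
- by rewrite map_polyC /= rmorph_nat.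
- by rewrite map_polyX.
by rewrite [cheb n.+2]/= rmorphB rmorphM /= map_polyX IH1 -/(cheb n.+1) IH2.
Qed.

Lemma horner_cheb n z : z != 0 -> (cheb n).[z + z^-1] = z ^+ n + z ^- n.
Proof.
move=> z0.
suff: (cheb n).[z + z^-1] = z ^+ n + z ^- n /\
      (cheb n.+1).[z + z^-1] = z ^+ n.+1 + z ^- n.+1 by case.
elim: n => [|n [IH1 IH2]]; split=> //.
- by rewrite hornerC expr0 invr1.
- by rewrite hornerX expr1.
rewrite [cheb n.+2]/= hornerD hornerN hornerM hornerX -/(cheb n.+1) IH1 IH2.
by rewrite !exprS; field; rewrite expf_neq0 ?z0.
Qed.

(** Since z + 1/z - r = (z - x)(z - 1/x)/z and x differs from 1/x, the left side has a simple zero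
    at x, so multiplicities are preserved. *)
Lemma mup_joukowski L n P x :
  (forall z, z != 0 -> L.[z] = z ^+ n * P.[z + z^-1]) ->
  x != 0 -> x != x^-1 -> mup x L = mup (x + x^-1) P.
Proof.
move=> LE x0 xV; set r := x + x^-1.
have [P0|P0] := eqVneq P 0.
  suff -> : L = 0 by rewrite P0 !mup0.
  by apply: eq_poly_nonzero => z z0; rewrite LE // P0 !horner0 mulr0.
have [m [Q]] := multiplicity_XsubC P r; rewrite P0 /= => Qr PE.
have [H [d HE]] := joukowski_numerator Q.
have E : 'X^(m + d) * L =
    ('X^n * (('X - (x^-1)%:P) ^+ m * H)) * ('X - x%:P) ^+ m.
  apply: eq_poly_nonzero => z z0.
  rewrite !(hornerM, hornerXn, horner_exp, hornerXsubC) LE // PE HE //.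
  rewrite !(hornerM, horner_exp, hornerXsubC).
  have -> : z + z^-1 - r = (z - x^-1) * (z - x) / z.
    by rewrite /r; field; rewrite x0 z0.
  by rewrite !exprMn exprVn exprD; field; rewrite expf_neq0.
have xn k : ~~ root 'X^k x by rewrite /root hornerXn expf_neq0.
rewrite PE mupMr // mup_XsubCX eqxx -(mupMr L (xn (m + d)%N)) E.
rewrite mupMr ?mup_XsubCX ?eqxx // !rootM (negPf (xn _)) /=; apply/norP; split.
  by rewrite /root horner_exp hornerXsubC expf_neq0 // subr_eq0.
by rewrite /root HE // mulf_neq0 ?expf_neq0.
Qed.

Lemma conj_exprz z (k : int) : (z ^ k)^* = z^* ^ k.
Proof. by case: k => n; rewrite ?NegzE -?exprnN ?fmorphV /= rmorphXn. Qed.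

(* [herm G] is the function z |-> u(z) u^star(z) when [G] evaluates u. *)
Definition herm (G : C -> C) z : C := G z * (G (z^*)^-1)^*.

Definition sym_fun (G : C -> C) e (c : int) :=
  (e = 1 \/ e = -1) /\ forall z, z != 0 -> G z = e * z ^ c * G z^-1.

Lemma herm_conj G z : (herm G z^*)^* = herm G z^-1.
Proof. by rewrite /herm rmorphM /= !conjCK fmorphV invrK mulrC. Qed.

Lemma sign_conj e : e = 1 \/ e = -1 -> e^* = e.
Proof. by case=> ->; rewrite ?rmorphN rmorph1. Qed.

(** The symmetry trades the value at 1/zbar for the one at zbar. At real z the result is e z^(-c) |G
    z|^2, whose sign is explicit. *)
Lemma herm_sym G e c z : sym_fun G e c -> z != 0 ->
  herm G z = e * z ^ (- c) * (G z * (G z^*)^*).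
Proof.
case=> eE Gs z0; rewrite /herm [G (z^*)^-1]Gs ?invr_eq0 ?conjC_eq0 // invrK.
rewrite !rmorphM /= conj_exprz fmorphV /= conjCK (sign_conj eE) exprz_inv; ring.
Qed.

Lemma herm_inv G e c z : sym_fun G e c -> z != 0 -> herm G z^-1 = herm G z.
Proof.
move=> Gs z0; rewrite (herm_sym Gs z0); case: Gs => eE Gs.
rewrite /herm fmorphV /= invrK [in RHS]Gs //.
have ee : e * e = 1 by case: eE => ->; rewrite ?mulrNN mulr1.
have zz : z ^ c * z ^ (- c) = 1 by rewrite -expfzDr // subrr expr0z.
transitivity (e * e * (z ^ c * z ^ (- c)) * (G z^-1 * (G z^*)^*)).
  by rewrite ee zz !mul1r.
ring.
Qed.

Lemma herm_poly G e c p (n : nat) z : sym_fun G e c ->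
  (forall z, z != 0 -> p.[z] = z ^+ n * G z) -> z != 0 ->
  herm G z = e * z ^ (- c - (2 * n)%N%:Z) * (p * cjp p).[z].
Proof.
move=> Gs pE z0; rewrite (herm_sym Gs z0) hornerM horner_conj.
rewrite !pE ?conjC_eq0 // !rmorphM rmorphXn /= conjCK expfzDr //.
by rewrite mul2n -addnn -exprnN exprD; field; rewrite expf_neq0.
Qed.

(** Here [om] is a real model of symmetry type e z^c, and [w] is om om^star in the variable X = z +
    1/z. The four instances below cover both signs and both parities of c. *)
Definition sym_weight om w e (c : int) :=
  [/\ e = 1 \/ e = -1, cjp om = om,
      forall z, z != 0 -> om.[z] = e * z ^ c * om.[z^-1] &
      forall z, z != 0 -> om.[z] * om.[z^-1] = w.[z + z^-1]].

Lemma sym_weight_1 : sym_weight 1 1 1 0.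
Proof.
split; [by left | by rewrite rmorph1 | |] => z z0;
  by rewrite !hornerC ?expr0z !mulr1.
Qed.

Lemma sym_weight_DX : sym_weight ('X + 1) ('X + 2%:P) 1 1.
Proof.
split; [by left | by rewrite rmorphD rmorph1 /= map_polyX | |] => z z0;
  by rewrite !(hornerD, hornerX, hornerC) ?expr1z; field; rewrite z0.
Qed.

Lemma sym_weight_BX : sym_weight ('X - 1) (2%:P - 'X) (-1) 1.
Proof.
split; [by right | by rewrite rmorphB rmorph1 /= map_polyX | |] => z z0;
  by rewrite !(hornerD, hornerN, hornerX, hornerC) ?expr1z; field; rewrite z0.
Qed.

Lemma sym_weight_X2 : sym_weight ('X ^+ 2 - 1) (4%:P - 'X ^+ 2) (-1) 2.
Proof.
split; [by right | by rewrite rmorphB rmorph1 rmorphXn /= map_polyX | |] => z z0;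
  rewrite !(hornerD, hornerN, hornerXn, hornerX, hornerC) -?exprnP;
  by field; rewrite z0.
Qed.

Lemma weight_numerator om f (t : int) : exists p (s : nat),
  forall z, z != 0 -> z ^- s * p.[z] = z ^ t * om.[z] * f.[z + z^-1].
Proof.
have [H [d HE]] := joukowski_numerator f.
(* The exponent |t| + t is nonnegative even when t is negative. *)
exists ('X^(absz ((absz t)%:Z + t)) * om * H), (d + absz t)%N => z z0.
rewrite !hornerM hornerXn HE //.
have -> : z ^ t = z ^- absz t * z ^+ absz ((absz t)%:Z + t).
  by rewrite exprnN [z ^+ _]exprnP -expfzDr //; congr (_ ^ _); lia.
by rewrite exprD; field; rewrite !expf_neq0.
Qed.

(** f(z + 1/z) is invariant under inversion, and z^t shifts the type by z^(2t); thus only the parity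
    of c is constrained. *)
Lemma sym_fun_weight om w e c f (t : int) (G : C -> C) : sym_weight om w e c ->
  (forall z, z != 0 -> G z = z ^ t * om.[z] * f.[z + z^-1]) ->
  sym_fun G e (c + (t + t)).
Proof.
case=> eE omr oms omw GE; split=> // z z0.
rewrite !GE ?invr_eq0 // invrK [z^-1 + _]addrC oms // exprz_inv !expfzDr //.
have zt : z ^ t != 0 by rewrite expfz_neq0.
by rewrite -invr_expz; field.
Qed.

(** The factor z^t is cancelled by its star, so the choice of t does not affect the result. *)
Lemma herm_weight om w e c f (t : int) (G : C -> C) z : sym_weight om w e c ->
  (forall z, z != 0 -> G z = z ^ t * om.[z] * f.[z + z^-1]) -> z != 0 ->
  herm G z = (w * (f * cjp f)).[z + z^-1].
Proof.
case=> eE omr oms omw GE z0.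
rewrite /herm !GE ?invr_eq0 ?conjC_eq0 // invrK !hornerM -omw //.
have omE y : (om.[y^*])^* = om.[y] by rewrite -horner_conj omr.
rewrite !rmorphM /= conj_exprz -fmorphV omE conjCK horner_conj.
rewrite rmorphD /= [(z^-1)^* + _]addrC.
have zt : z ^ t != 0 by rewrite expfz_neq0.
by rewrite exprz_inv -invr_expz; field.
Qed.

End Joukowski.

(** * Evaluation of Laurent polynomials *)

Section Evaluation.
Variable R : realType.
Local Notation C := R[i].
Implicit Types (u v : laurent R) (z x r : C) (k c : int) (p P : {poly C}).

Definition ev u z : C :=
  \sum_(j < (2 * lb u).+1) lc u (j%:Z - (lb u)%:Z) * z ^ (j%:Z - (lb u)%:Z).

Lemma lpolyE u (j : nat) : (lpoly u)`_j = lc u (j%:Z - (lb u)%:Z).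
Proof. by rewrite coef_poly; case: ifP => // jn; rewrite lbP //; lia. Qed.

Lemma horner_lpoly u z : z != 0 -> (lpoly u).[z] = z ^+ lb u * ev u z.
Proof.
move=> z0; rewrite horner_poly /ev mulr_sumr; apply: eq_bigr => j _.
by rewrite mulrCA [z ^+ lb u]exprnP -expfzDr // addrCA subrr addr0.
Qed.

Lemma lpoly_shift u m (j : nat) :
  ('X^m * lpoly u)`_j = lc u (j%:Z - (m + lb u)%N%:Z).
Proof.
rewrite coefXnM; case: ltnP => h; first by rewrite lbP //; lia.
by rewrite lpolyE; congr lc; lia.
Qed.

(** Any s with no exponent below -s will do, which frees the evaluation from the recorded bound
    [lb u]. *)
Lemma ev_poly u p (s : nat) :
  (forall j : nat, p`_j = lc u (j%:Z - s%:Z)) ->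
  (forall k, k < - s%:Z -> lc u k = 0) ->
  forall z, z != 0 -> ev u z = z ^- s * p.[z].
Proof.
move=> pE u0 z z0.
have E : 'X^s * lpoly u = 'X^(lb u) * p.
  apply/polyP => j; rewrite lpoly_shift coefXnM; case: ltnP => h.
    by rewrite u0 //; lia.
  by rewrite pE; congr lc; lia.
move/(congr1 (fun q => q.[z])): E; rewrite !hornerM !hornerXn horner_lpoly //.
rewrite mulrCA => /(mulfI (expf_neq0 _ z0)) <-.
by rewrite mulKf // expf_neq0.
Qed.

(** Equality is stated for coefficients because [lb] is not determined by them. *)
Lemma ev_inj u v : (forall z, z != 0 -> ev u z = ev v z) ->
  forall k, lc u k = lc v k.
Proof.
move=> uv k.
have [h|h] := ltP k (- (lb u + lb v)%N%:Z); first by rewrite !lbP //; lia.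
have E : 'X^(lb v) * lpoly u = 'X^(lb u) * lpoly v.
  apply: eq_poly_nonzero => z z0.
  by rewrite !hornerM !hornerXn !horner_lpoly // uv // mulrCA.
move/(congr1 (fun q : {poly C} => q`_(absz (k + (lb u + lb v)%N%:Z)))): E.
by rewrite !lpoly_shift; congr (lc _ _ = lc _ _); lia.
Qed.

Lemma ev_ext u v : (forall k, lc u k = lc v k) ->
  forall z, z != 0 -> ev u z = ev v z.
Proof.
move=> uv z z0; rewrite (@ev_poly u (lpoly v) (lb v)) //; last first.
- by move=> k h; rewrite uv lbP //; lia.
- by move=> j; rewrite uv lpolyE.
by rewrite horner_lpoly // mulKf // expf_neq0.
Qed.

Lemma lrev_bound u k : (lb u < absz k)%N -> lc u (- k) = 0.
Proof. by move=> h; rewrite lbP // abszN. Qed.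
Definition lrev u : laurent R := Laurent (@lrev_bound u).

Lemma ev_lrev u z : ev (lrev u) z = ev u z^-1.
Proof.
rewrite /ev /= [RHS](reindex_inj rev_ord_inj) /=; apply: eq_bigr => j _.
have jn := ltn_ord j; rewrite exprz_inv; congr (lc _ _ * _ ^ _); lia.
Qed.

Lemma lconj_bound u k : (lb u < absz k)%N -> (lc u k)^* = 0.
Proof. by move=> h; rewrite lbP // rmorph0. Qed.
Definition lconj u : laurent R := Laurent (@lconj_bound u).

Lemma ev_lconj u z : ev (lconj u) z = (ev u z^*)^*.
Proof.
rewrite /ev /= rmorph_sum; apply: eq_bigr => j _.
by rewrite rmorphM /= conj_exprz conjCK.
Qed.

Lemma ev_lstar u z : ev (lstar u) z = (ev u (z^*)^-1)^*.
Proof. by rewrite -fmorphV -ev_lconj -ev_lrev. Qed.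

Lemma lmul_bound u v k : (lb u + lb v < absz k)%N -> lmul u v k = 0.
Proof.
move=> h; apply: big1 => j _; rewrite [lc v _]lbP ?mulr0 //.
have := ltn_ord j; lia.
Qed.
Definition lmulL u v : laurent R := Laurent (@lmul_bound u v).

Lemma lpoly_lmul u v : lpoly (lmulL u v) = lpoly u * lpoly v.
Proof.
apply/polyP => i; rewrite lpolyE coefM /= /lmul.
(* [lmul] sums over the support window of u, the polynomial product over j <= i; both are padded
   with zero terms to a common range. *)
transitivity (\sum_(0 <= j < i.+1 + (2 * lb u).+1)
   (lpoly u)`_j * lc v ((i%:Z - (lb u + lb v)%N%:Z) - (j%:Z - (lb u)%:Z))).
  rewrite [RHS](big_cat_nat (n := (2 * lb u).+1)) //=; last by lia.
  rewrite -[LHS]addr0 big_mkord; congr (_ + _).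
    by apply: eq_bigr => j _; rewrite lpolyE.
  apply/esym; rewrite big_nat; apply: big1 => j /andP[h _].
  by rewrite lpolyE lbP ?mul0r //; lia.
rewrite (big_cat_nat (n := i.+1)) //=; last by lia.
rewrite -[RHS]addr0 big_mkord; congr (_ + _).
  apply: eq_bigr => j _; rewrite [(lpoly v)`_ _]lpolyE; congr (_ * lc _ _).
  have := ltn_ord j; lia.
rewrite big_nat; apply: big1 => j /andP[h _].
by rewrite [lc v _]lbP ?mulr0 //; lia.
Qed.

Lemma ev_lmul u v z : z != 0 -> ev (lmulL u v) z = ev u z * ev v z.
Proof.
move=> z0; have zn n : z ^+ n != 0 by rewrite expf_neq0.
apply: (mulfI (zn (lb u + lb v)%N)).
by rewrite -[LHS](horner_lpoly (lmulL u v)) // lpoly_lmul hornerM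
  !horner_lpoly // exprD mulrACA.
Qed.

Lemma lsub_bound u v k : (lb u + lb v < absz k)%N -> lc u k - lc v k = 0.
Proof. by move=> h; rewrite !lbP ?subrr //; lia. Qed.
Definition lsub u v : laurent R := Laurent (@lsub_bound u v).

Lemma ev_lsub u v z : z != 0 -> ev (lsub u v) z = ev u z - ev v z.
Proof.
move=> z0; have zn n : z ^+ n != 0 by rewrite expf_neq0.
rewrite (@ev_poly (lsub u v) ('X^(lb v) * lpoly u - 'X^(lb u) * lpoly v)
  (lb u + lb v)%N) //; last first.
- by move=> k h; rewrite /= !lbP ?subrr //; lia.
- by move=> j; rewrite coefB !lpoly_shift /=; congr (lc _ _ - lc _ _); lia.
rewrite hornerD hornerN !hornerM !hornerXn !horner_lpoly //.
by rewrite exprD; field; rewrite !zn.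
Qed.

Lemma ltwist_bound u (e : C) c k :
  (lb u + absz c < absz k)%N -> e * lc u (c - k) = 0.
Proof. by move=> h; rewrite lbP ?mulr0 //; lia. Qed.
(** This is e z^c u(1/z), the right side of the symmetry relation. *)
Definition ltwist u e c : laurent R := Laurent (@ltwist_bound u e c).

Lemma ev_ltwist u e c z : z != 0 -> ev (ltwist u e c) z = e * z ^ c * ev u z^-1.
Proof.
move=> z0; have zn n : z ^+ n != 0 by rewrite expf_neq0.
rewrite (@ev_poly (ltwist u e c) (e *: ('X^(absz ((absz c)%:Z + c)) * lpoly (lrev u)))
  (absz c + lb u)%N) //; last first.
- by move=> k h; rewrite /= lbP ?mulr0 //; lia.
- by move=> j; rewrite coefZ lpoly_shift /=; congr (_ * lc _ _); lia.
rewrite hornerZ hornerM hornerXn horner_lpoly // ev_lrev /= mulrCA -mulrA.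
congr (_ * _); rewrite !mulrA; congr (_ * _).
rewrite !exprnP exprnN -!expfzDr //; congr (_ ^ _); lia.
Qed.

Lemma has_symP u e c : Defs.has_sym u e c <-> sym_fun (ev u) e c.
Proof.
split=> -[eE H]; split=> //.
  by move=> z z0; rewrite -ev_ltwist //; apply: ev_ext => // k; rewrite /= H.
by apply: (@ev_inj u (ltwist u e c)) => z z0; rewrite ev_ltwist // H.
Qed.

Lemma difference_evP u u1 u2 :
  (forall k, lmul u1 (lstar u1) k - lmul u2 (lstar u2) k = lc u k) <->
  (forall z, z != 0 -> ev u z =
    herm (ev u1) z - herm (ev u2) z).
Proof.
pose d := lsub (lmulL u1 (lstar u1)) (lmulL u2 (lstar u2)).
have dE z : z != 0 -> ev d z =
    herm (ev u1) z - herm (ev u2) z.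
  by move=> z0; rewrite ev_lsub // !ev_lmul // !ev_lstar.
split=> H.
  by move=> z z0; rewrite -dE //; apply: ev_ext => // k; rewrite -H.
by apply: (@ev_inj d u) => z z0; rewrite dE // H.
Qed.

Lemma laurent_of_poly_bound p (s : nat) k : (s + size p < absz k)%N ->
  (if k + s%:Z is Posz i then p`_i else 0) = 0.
Proof.
case E: (k + s%:Z) => [i|//] h; rewrite nth_default //.
by move: h E; move: (size p) => N; lia.
Qed.
Definition laurent_of_poly p s : laurent R := Laurent (@laurent_of_poly_bound p s).

Lemma ev_laurent_of_poly p s z :
  z != 0 -> ev (laurent_of_poly p s) z = z ^- s * p.[z].
Proof.
move=> z0; apply: ev_poly => // [j|k h] /=; first by rewrite subrK.
by case E: (k + s%:Z) => [i|//]; lia.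
Qed.

(** The hypotheses give u(z) = u(1/z). Averaging the two pairs z^k with z^(-k), and [cheb] writes
    each pair in X; hence the halved coefficients. *)
Lemma joukowski_poly u :
  (forall k, lc u k \is Num.real) -> (forall k, lc (lstar u) k = lc u k) ->
  exists2 P, cjp P = P & forall z, z != 0 -> ev u z = P.[z + z^-1].
Proof.
move=> ur us.
have rev z : z != 0 -> ev u z = ev u z^-1.
  move=> z0; rewrite -ev_lrev; apply: ev_ext => // k /=.
  by rewrite -us /= (CrealP (ur _)).
exists (\sum_(j < (2 * lb u).+1)
   (lc u (j%:Z - (lb u)%:Z) / 2) *: cheb C (absz (j%:Z - (lb u)%:Z))).
  rewrite rmorph_sum; apply: eq_bigr => j _ /=.
  by rewrite map_polyZ cheb_real rmorphM fmorphV /= (CrealP (ur _)) rmorph_nat.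
move=> z z0; have two : (2 : C) != 0 by rewrite pnatr_eq0.
apply: (mulfI two); rewrite [LHS]mulrC mulrDr mulr1 {2}rev // /ev -big_split /=.
rewrite horner_sum mulr_sumr; apply: eq_bigr => j _.
rewrite hornerZ horner_cheb // -mulrDr mulrA [2 * _]mulrC divfK //; congr (_ * _).
case: (_ - _) => m; rewrite ?NegzE -?exprnN /=; first by rewrite -!exprnP exprVn.
by rewrite exprVn invrK addrC.
Qed.

End Evaluation.

(** * Differences of squares *)

Section DifferenceOfSquares.
Variable R : realType.
Local Notation C := R[i].
Implicit Types (u v : laurent R) (z x r e eps : C) (k c t : int).
Implicit Types (f g om w P : {poly C}).

Lemma laurent_of_weight om w e c f t : sym_weight om w e c ->
  exists2 v, Defs.has_sym v e (c + (t + t)) &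
    forall z, z != 0 -> herm (ev v) z = (w * (f * cjp f)).[z + z^-1].
Proof.
move=> W; have [p [s pE]] := weight_numerator om f t.
exists (laurent_of_poly p s).
  apply/has_symP; apply: (sym_fun_weight W) => z z0.
  by rewrite ev_laurent_of_poly // pE.
move=> z; apply: (herm_weight (t := t) W) => {}z z0.
by rewrite ev_laurent_of_poly // pE.
Qed.

(** The types of the models need only have the right parity: multiplying the first by z^t adjusts c1
    - c2 to c. *)
Lemma DOS_of_weights u P (w1 w2 om1 om2 : {poly C}) (e1 e2 : C) (c1 c2 c : int) f g :
  (forall z, z != 0 -> ev u z = P.[z + z^-1]) ->
  sym_weight om1 w1 e1 c1 -> sym_weight om2 w2 e2 c2 ->
  P = w1 * (f * cjp f) - w2 * (g * cjp g) ->
  odd (absz (c1 - c2)) = odd (absz c) ->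
  DOS u (e1 / e2) c.
Proof.
move=> uE W1 W2 PE pc.
have [t tE] : exists t, c = c1 - c2 + (t + t).
  by exists ((c - (c1 - c2)) %/ 2)%Z; lia.
have [u1 s1 E1] := laurent_of_weight f t W1.
have [u2 s2 E2] := laurent_of_weight g 0 W2.
exists u1, u2, e1, e2, (c1 + (t + t)), (c2 + (0 + 0)); split=> //.
  by apply/difference_evP => z z0; rewrite E1 // E2 // uE // PE hornerD hornerN.
lia.
Qed.

(** Each u_i u_i^star is invariant under inversion by its symmetry; [herm_conj] turns this into
    invariance under conjugation of the coefficients. *)
Lemma DOS_real u eps c : DOS u eps c ->
  (forall k, lc u k \is Num.real) /\ (forall k, lc (lstar u) k = lc u k).
Proof.
case=> u1 [u2 [e1 [e2 [c1 [c2 [/has_symP s1 /has_symP s2 /difference_evP uE _ _]]]]]].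
have sym z : z != 0 -> ev u z^-1 = ev u z.
  move=> z0; have zV : z^-1 != 0 by rewrite invr_eq0.
  apply: etrans (uE _ zV) _; apply: etrans _ (esym (uE _ z0)).
  exact: (f_equal2 (fun a b => a - b) (herm_inv s1 z0) (herm_inv s2 z0)).
have real k : (lc u k)^* = lc u k.
  apply: (@ev_inj R (lconj u) u) => z z0.
  have zc : z^* != 0 by rewrite conjC_eq0.
  rewrite ev_lconj; apply: etrans (congr1 Num.conj (uE _ zc)) _.
  apply: etrans _ (esym (uE _ z0)); rewrite rmorphB.
  apply: (f_equal2 (fun a b => a - b)); apply: etrans (herm_conj _ _) _.
    exact: herm_inv s1 z0.
  exact: herm_inv s2 z0.
split=> k; first by apply/CrealP.
rewrite /= real.
by apply: (@ev_inj R (lrev u) u) => z z0; rewrite ev_lrev sym.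
Qed.

(** Clearing denominators gives a form with weights e1 X^a1 and -e2 X^a2. Their product at x is -eps
    x^(a1 + a2), positive by hypothesis, so [mup_form_even] applies. *)
Lemma DOS_even u eps c x : DOS u eps c -> x \is Num.real -> x != 0 ->
  (forall n : nat, odd n = odd (absz c) -> eps * x ^+ n < 0) ->
  ~~ odd (Zmult u x).
Proof.
case=> u1 [u2 [e1 [e2 [c1 [c2 [/has_symP s1 /has_symP s2 /difference_evP uE eE cE]]]]]].
move=> xr x0 neg.
(* M is large enough for the three exponents to be nonnegative before [absz] is taken. *)
pose M := (2 * (lb u + lb u1 + lb u2 + absz c1 + absz c2))%N.
pose a0 := (M - lb u)%N.
pose a1 := absz (M%:Z - c1 - (2 * lb u1)%N%:Z)%R.
pose a2 := absz (M%:Z - c2 - (2 * lb u2)%N%:Z)%R.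
have E : 'X^a0 * lpoly u = (e1 *: 'X^a1) * (lpoly u1 * cjp (lpoly u1)) +
                           (- e2 *: 'X^a2) * (lpoly u2 * cjp (lpoly u2)).
  apply: eq_poly_nonzero => z z0.
  have -> : ('X^a0 * lpoly u).[z] = z ^ M%:Z * ev u z.
    rewrite hornerM hornerXn horner_lpoly // mulrA -exprD exprnP.
    by congr (_ ^ _ * _); rewrite /a0; lia.
  rewrite uE // (herm_poly s1 (horner_lpoly u1)) // (herm_poly s2 (horner_lpoly u2)) //.
  rewrite hornerD ![(_ *: _ * _).[z]]hornerM !hornerZ !hornerXn.
  have -> : z ^+ a1 = z ^ M%:Z * z ^ (- c1 - (2 * lb u1)%N%:Z).
    by rewrite exprnP -expfzDr //; congr (_ ^ _); rewrite /a1; lia.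
  have -> : z ^+ a2 = z ^ M%:Z * z ^ (- c2 - (2 * lb u2)%N%:Z).
    by rewrite exprnP -expfzDr //; congr (_ ^ _); rewrite /a2; lia.
  by rewrite mulrBr !mulNr -!mulrA ![z ^ M%:Z * (_ * (z ^ _ * _))]mulrCA.
have xn n : ~~ root 'X^n x by rewrite /root hornerXn expf_neq0.
rewrite /Zmult -(mupMr _ (xn a0)) E; apply: mup_form_even => //.
  rewrite !hornerZ !hornerXn mulrACA -exprD.
  have -> : e1 * - e2 = - eps.
    by rewrite -eE; case: s2 => -[] -> _; rewrite ?invrN invr1 mulrN.
  by rewrite mulNr oppr_gt0; apply: neg; rewrite -cE /a1 /a2; lia.
rewrite hornerZ hornerXn realM ?realX //.
by case: s1 => -[] -> _; rewrite ?realN real1.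
Qed.

(** x is the smaller root of x^2 - r x + 1; the other root is its inverse. *)
Lemma joukowski_preimage r : 2 < r ->
  exists2 x : R, 0 < x < 1 & x%:C%C + (x%:C%C)^-1 = r.
Proof.
move=> r2; have rr : r \is Num.real by rewrite gtr0_real // (lt_trans _ r2).
case/complex_realP: rr r2 => k -> {r}.
rewrite -[2]/(2%:R) -(rmorph_nat (real_complex R)) ltcR => k2.
pose s := Num.sqrt (k ^+ 2 - 4).
have sE : s ^+ 2 = k ^+ 2 - 4 by rewrite sqr_sqrtr //; nra.
have s0 : 0 <= s by rewrite sqrtr_ge0.
have x0 : 0 < (k - s) / 2 by nra.
exists ((k - s) / 2); first by rewrite x0 /=; nra.
rewrite -fmorphV -rmorphD /=; congr (_%:C)%C.
have E : ((k - s) / 2) * ((k + s) / 2) = 1 by nra.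
have -> : ((k - s) / 2)^-1 = (k + s) / 2.
  by apply: (mulfI (lt0r_neq0 x0)); rewrite mulfV ?lt0r_neq0.
by field.
Qed.

End DifferenceOfSquares.

(** * Linear factors in terms of p and q, and the unconditional case *)

Section RealRoots.
Variable C : numClosedFieldType.

(** X - r = -((r + 2) - (X + 2)), with r + 2 a square when r >= -2. *)
Lemma good_root_ge (r : C) : r \is Num.real -> ~~ (r < - 2) ->
  exists (a b s : C), [/\ a \is Num.real, b \is Num.real, s = 1 \/ s = -1 &
    'X - r%:P = s%:P * ((a ^+ 2)%:P * 1 + (b ^+ 2)%:P * - ('X + 2%:P))].
Proof.
move=> rr; rewrite -real_leNgt ?realN ?realn // => h.
have r2 : 0 <= r + 2 by rewrite -[2]opprK subr_ge0.
exists (sqrtC (r + 2)), 1, (-1); rewrite ger0_real ?sqrtC_ge0 // real1.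
split; [by [] | by [] | by right |].
by rewrite sqrtCK expr1n polyCN polyCD; ring.
Qed.

Lemma good_root_le (r : C) : r \is Num.real -> ~~ (2 < r) ->
  exists (a b s : C), [/\ a \is Num.real, b \is Num.real, s = 1 \/ s = -1 &
    'X - r%:P = s%:P * ((a ^+ 2)%:P * 1 + (b ^+ 2)%:P * ('X - 2%:P))].
Proof.
move=> rr; rewrite -real_leNgt ?realn // => h.
have r2 : 0 <= 2 - r by rewrite subr_ge0.
exists (sqrtC (2 - r)), 1, 1; rewrite ger0_real ?sqrtC_ge0 // real1.
split; [by [] | by [] | by left |].
by rewrite sqrtCK expr1n polyCB; ring.
Qed.

(** X - r = (2 - r)/4 (X + 2) + (r + 2)/4 (X - 2), with both coefficients nonnegative for r in
    [-2, 2]. *)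
Lemma good_root_between (r : C) : r \is Num.real -> ~~ ((r < - 2) || (2 < r)) ->
  exists (a b s : C), [/\ a \is Num.real, b \is Num.real, s = 1 \/ s = -1 &
    'X - r%:P = s%:P * ((a ^+ 2)%:P * ('X + 2%:P) + (b ^+ 2)%:P * ('X - 2%:P))].
Proof.
move=> rr; rewrite negb_or -!real_leNgt ?realN ?realn // => /andP[h1 h2].
have r1 : 0 <= (2 - r) / 4 by rewrite divr_ge0 ?ler0n // subr_ge0.
have r2 : 0 <= (r + 2) / 4 by rewrite divr_ge0 ?ler0n // -[2]opprK subr_ge0.
exists (sqrtC ((2 - r) / 4)), (sqrtC ((r + 2) / 4)), 1.
rewrite !ger0_real ?sqrtC_ge0 //.
split; [by [] | by [] | by left |].
rewrite !sqrtCK polyC1 mul1r mulrDr mulrBr addrACA -mulrDl -polyCD -mulrBl.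
rewrite -polyCB -polyCM.
have -> : (2 - r) / 4 + (r + 2) / 4 = 1 by field.
have -> : ((2 - r) / 4 - (r + 2) / 4) * 2 = - r by field.
by rewrite mul1r polyCN.
Qed.

(** P = ((P + 1)/2)^2 - ((P - 1)/2)^2. *)
Lemma real_poly_square_difference (P : {poly C}) : cjp P = P ->
  let f := (2^-1)%:P * (P + 1) in let g := (2^-1)%:P * (P - 1) in
  P = 1 * (f * cjp f) - 1 * (g * cjp g).
Proof.
move=> Pr /=; rewrite !rmorphM rmorphB rmorphD rmorph1 /= Pr map_polyC /=.
have -> : (2^-1)^* = 2^-1 :> C by rewrite fmorphV /= rmorph_nat.
have h : (2^-1)%:P * 2 = 1 :> {poly C}.
  by rewrite -[X in _ * X]polyC_natr -polyCM mulVf // pnatr_eq0.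
transitivity (((2^-1)%:P * 2) ^+ 2 * P); first by rewrite h expr1n mul1r.
by ring.
Qed.

End RealRoots.

(** * From even multiplicities to the DOS property *)

Section Sufficiency.
Variable R : realType.
Local Notation C := R[i].
Implicit Types (u : laurent R) (r s : C) (P f g : {poly C}) (c : int).

Lemma Zmult_joukowski u P (x : R) :
  (forall z : C, z != 0 -> ev u z = P.[z + z^-1]) -> x != 0 -> x ^+ 2 != 1 ->
  Zmult u x%:C%C = mup (x%:C%C + (x%:C%C)^-1) P.
Proof.
move=> uE x0 x1.
have X0 : x%:C%C != 0 :> C by rewrite fmorph_eq0.
apply: (mup_joukowski (n := lb u)) => //.
  by move=> z z0; rewrite horner_lpoly // uE.
apply: contraNneq x1 => E; apply/eqP/(fmorph_inj (real_complex R)).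
by rewrite rmorphXn rmorph1 /= expr2 {2}E mulfV.
Qed.

Lemma mup_even_gt2 u P r :
  (forall z : C, z != 0 -> ev u z = P.[z + z^-1]) ->
  (forall x : R, 0 < x < 1 -> ~~ odd (Zmult u x%:C%C)) ->
  2 < r -> ~~ odd (mup r P).
Proof.
move=> uE H /joukowski_preimage [x x01 <-]; have /andP[x0 x1] := x01.
rewrite -(Zmult_joukowski uE) ?H ?lt0r_neq0 //.
by rewrite lt_eqF // exprn_ilt1 // ltW.
Qed.

(** Negating both x and r reduces this to the preimage of -r > 2 in (0,1). *)
Lemma mup_even_ltN2 u P r :
  (forall z : C, z != 0 -> ev u z = P.[z + z^-1]) ->
  (forall x : R, -1 < x < 0 -> ~~ odd (Zmult u x%:C%C)) ->
  r < - 2 -> ~~ odd (mup r P).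
Proof.
rewrite -[r]opprK ltrN2 => uE H /joukowski_preimage [x x01 <-]; have /andP[x0 x1] := x01.
have -> : - (x%:C%C + (x%:C%C)^-1) = (- x)%:C%C + ((- x)%:C%C)^-1 :> C.
  by rewrite rmorphN invrN opprD.
rewrite -(Zmult_joukowski uE) ?H ?oppr_eq0 ?lt0r_neq0 ?ltrN2 ?oppr_lt0 ?x0 ?x1 //.
by rewrite sqrrN lt_eqF // exprn_ilt1 // ltW.
Qed.

(** A sign -1 is removed by exchanging u1 and u2: the quotient of the signs e1, e2 and the parity of
    c1 - c2 do not change. *)
Lemma DOS_of_signed_weights u P (w1 w2 om1 om2 : {poly C}) (e1 e2 s : C) (c1 c2 c : int) f g :
  (forall z : C, z != 0 -> ev u z = P.[z + z^-1]) ->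
  sym_weight om1 w1 e1 c1 -> sym_weight om2 w2 e2 c2 ->
  s = 1 \/ s = -1 ->
  s%:P * P = w1 * (f * cjp f) - w2 * (g * cjp g) ->
  odd (absz (c1 - c2)) = odd (absz c) ->
  DOS u (e1 / e2) c.
Proof.
move=> uE W1 W2 [] -> PE pc.
  by apply: (DOS_of_weights (f := f) (g := g) uE W1 W2 _ pc); rewrite -PE mul1r.
have -> : e1 / e2 = e2 / e1.
  by case: W1 W2 => [[] -> _ _ _] [[] -> _ _ _]; rewrite ?invrN ?invr1 ?mulr1 ?mul1r.
apply: (DOS_of_weights (f := g) (g := f) uE W2 W1).
  by rewrite -opprB -PE polyCN mulN1r opprK.
by rewrite -pc -opprB abszN.
Qed.

End Sufficiency.

Theorem theorem1p2 (R : realType) (eps : R[i]) (c : int) :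
  (eps = 1 \/ eps = -1) ->
  forall u : laurent R,
    DOS u eps c <->
    ((forall k : int, lc u k \is Num.real) /\ (forall k : int, lc (lstar u) k = lc u k)) /\
    (if eps == 1 then
       (if odd (absz c) then
          forall x : R, -1 < x < 0 -> ~~ odd (Zmult u x%:C%C)
        else True)
     else
       (if odd (absz c) then
          forall x : R, 0 < x < 1 -> ~~ odd (Zmult u x%:C%C)
        else
          forall x : R, (-1 < x < 0) \/ (0 < x < 1) -> ~~ odd (Zmult u x%:C%C))).
Proof.
have N11 : (-1 == 1 :> R[i]) = false.
  by apply/negbTE; rewrite lt_eqF // (@lt_trans _ _ 0) ?ltrN10 ?ltr01.
move=> epsE u; split=> [H|[[ur us] H]].
  split; first exact: DOS_real H.
  (* It remains to see that eps x^n < 0 on the stated intervals whenever n has the parity of c. *)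
  have even x : x != 0 -> (forall n, odd n = odd (absz c) -> eps * (x ^+ n)%:C%C < 0) ->
      ~~ odd (Zmult u x%:C%C).
    move=> x0 h; apply: (DOS_even H).
    - by apply/complex_realP; exists x.
    - by rewrite fmorph_eq0.
    - by move=> n nc; rewrite -rmorphXn; apply: h.
  case: epsE even => ->; rewrite ?eqxx ?N11; case: ifP => // oc even x hx; apply: even.
  - by rewrite lt_eqF //; case/andP: hx.
  - move=> n nc; rewrite mul1r -(rmorph0 (real_complex R)) ltcR.
    by rewrite exprn_odd_lt0 ?nc //; case/andP: hx.
  - by rewrite gt_eqF //; case/andP: hx.
  - move=> n nc; rewrite mulN1r oppr_lt0 -(rmorph0 (real_complex R)) ltcR.
    by rewrite exprn_gt0 //; case/andP: hx.
  - by case: hx => /andP[h1 h2]; [rewrite lt_eqF | rewrite gt_eqF].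
  - move=> n nc; rewrite mulN1r oppr_lt0 -(rmorph0 (real_complex R)) ltcR.
    rewrite exprn_even_gt0 ?nc // orbC.
    by case: hx => /andP[h1 h2]; [rewrite lt_eqF | rewrite gt_eqF].
have [P Pr uE] := joukowski_poly ur us.
have Xr k : map_poly Num.conj ('X + k%:R%:P) = 'X + k%:R%:P :> {poly R[i]}.
  by rewrite rmorphD /= map_polyX map_polyC /= rmorph_nat.
have Xr' k : map_poly Num.conj ('X - k%:R%:P) = 'X - k%:R%:P :> {poly R[i]}.
  by rewrite rmorphB /= map_polyX map_polyC /= rmorph_nat.
case: epsE H => ->; rewrite ?eqxx ?N11; case: ifP => oc H.
(* With p = 1 both shapes read f fbar - (X + 2) g gbar, so one pair of weights, of types 1 and z,
   serves both. *)
- have [||r _ rb|s sE F] := @real_poly_signed_form _ 1 (- ('X + 2%:P)) (fun r => r < - 2)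
    _ _ (@good_root_ge _) P Pr.
  + by rewrite rmorph1.
  + by rewrite rmorphN /= Xr.
  + exact: mup_even_ltN2 uE H rb.
  rewrite -[1]divr1.
  case: F => -[f [g FE]];
    apply: (DOS_of_signed_weights (f := f) (g := g) uE (sym_weight_1 _) (sym_weight_DX _) sE);
    rewrite ?oc // FE; ring.
- rewrite -[1]divr1.
  apply: (DOS_of_weights (f := (2^-1)%:P * (P + 1)) (g := (2^-1)%:P * (P - 1))
    uE (sym_weight_1 _) (sym_weight_1 _)).
    exact: real_poly_square_difference.
  by rewrite oc.
- have [||r _ rb|s sE F] := @real_poly_signed_form _ 1 ('X - 2%:P) (fun r => 2 < r)
    _ _ (@good_root_le _) P Pr.
  + by rewrite rmorph1.
  + by rewrite Xr'.
  + exact: mup_even_gt2 uE H rb.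
  have -> : -1 = 1 / -1 :> R[i] by rewrite invrN1 mul1r.
  case: F => -[f [g FE]];
    apply: (DOS_of_signed_weights (f := f) (g := g) uE (sym_weight_1 _) (sym_weight_BX _) sE);
    rewrite ?oc // FE; ring.
(* Now the shapes differ: p q = -(4 - X^2) leads to types 1 and -z^2, while p = X + 2, q = -(2 - X)
   lead to z and -z. Either way the quotient has sign -1 and even exponent. *)
- have [||r _ rb|s sE F] := @real_poly_signed_form _ ('X + 2%:P) ('X - 2%:P)
    (fun r => (r < - 2) || (2 < r)) _ _ (@good_root_between _) P Pr.
  + by rewrite Xr.
  + by rewrite Xr'.
  + case/orP: rb => rb.
      by apply: (mup_even_ltN2 uE) rb => x hx; apply: H; left.
    by apply: (mup_even_gt2 uE) rb => x hx; apply: H; right.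
  have -> : -1 = 1 / -1 :> R[i] by rewrite invrN1 mul1r.
  case: F => -[f [g FE]].
    apply: (DOS_of_signed_weights (f := f) (g := g) uE (sym_weight_1 _) (sym_weight_X2 _) sE);
    rewrite ?oc // FE; ring.
  apply: (DOS_of_signed_weights (f := f) (g := g) uE (sym_weight_DX _) (sym_weight_BX _) sE);
    rewrite ?oc // FE; ring.
Qed.
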